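(* Fix $W>0$ and consider the system $y_{t+1}=a\phi_b(y_t)+u_t+w_{t+1}$, $t\ge0$, with disturbances satisfying $\sup_{t\ge1}|w_t|\le W$. Let $\mathcal A\subset\mathbb R$ be a nondegenerate compact interval, and let $\mathcal B\subset(0,\infty)$ be a nonempty finite set. Put $b_{\min}=\min_{b\in\mathcal B}b$ and $b_{\max}=\max_{b\in\mathcal B}b$. If $b_{\min}<b_{\max}$ and $3\sqrt3/2<b_{\max}<4$, then $\mathcal A\times\mathcal B$ is robustly stabilizable, whereas $\mathcal A\times[b_{\min},b_{\max}]$ is not robustly stabilizable.
   Context: For $b>0$ and $y\in\mathbb R$, $\phi_b(y)=\operatorname{sgn}(y)|y|^b$ (so $\phi_b(0)=0$). The state is $y_t\in\mathbb R$, the input is $u_t\in\mathbb R$, and the true parameter $p^\star=(a^\star,b^\star)\in\mathbb R\times(0,\infty)$ is unknown to the controller; trajectories are generated by $y_{t+1}=a^\star\phi_{b^\star}(y_t)+u_t+w_{t+1}$. A feedback law is a sequence $\mu=(\mu_t)_{t\ge0}$ of maps $\mu_t:\mathbb R^{t+1}\to\mathbb R$ (no regularity required) with $u_t=\mu_t(y_0,\ldots,y_t)$; it may depend on the prescribed parameter set and on $W$, but not on $p^\star$ or the disturbances. A nonempty set $\mathcal P\subset\mathbb R\times(0,\infty)$ is robustly stabilizable if there is a feedback law such that $\sup_{t\ge0}|y_t|<\infty$ for every $p^\star\in\mathcal P$, every $y_0\in\mathbb R$, and every disturbance sequence with $\sup_{t\ge1}|w_t|\le W$. *)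

(* Defs.v *)
From mathcomp Require Import all_boot all_order all_algebra.
From mathcomp Require Import all_classical all_reals all_analysis.

Set Implicit Arguments.
Unset Strict Implicit.
Unset Printing Implicit Defensive.

Import Order.TTheory GRing.Theory Num.Theory.
Local Open Scope classical_set_scope.
Local Open Scope ring_scope.

Definition phi (R : realType) (b y : R) : R := Num.sg y * (`|y| `^ b).

(* At time t the law sees the row vector (y_0, ..., y_t). *)
Definition feedback_law (R : realType) : Type :=
  forall t : nat, 'rV[R]_t.+1 -> R.

(* The value w 0 is never used: disturbances are indexed from time 1. *)
Definition trajectory (R : realType) (mu : feedback_law R) (a b : R)
    (w y : nat -> R) : Prop :=
  forall t : nat,
    y t.+1 = a * phi b (y t) + mu t (\row_(i < t.+1) y i) + w t.+1.

(* Meant for nonempty P included in the half-plane of pairs (a, b) with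
   0 < b. The initial state y 0 is arbitrary, and each choice of y 0 and w
   determines exactly one trajectory y. *)
Definition robustly_stabilizable (R : realType) (W : R) (P : set (R * R)) :
    Prop :=
  exists mu : feedback_law R,
    forall (p : R * R) (w y : nat -> R),
      P p ->
      (forall t : nat, (1 <= t)%N -> `|w t| <= W) ->
      trajectory mu p.1 p.2 w y ->
      has_ubound (range (fun t : nat => `|y t|)).

Definition is_minimum (R : realType) (B : set R) (m : R) : Prop :=
  B m /\ lbound B m.

Definition is_maximum (R : realType) (B : set R) (m : R) : Prop :=
  B m /\ ubound B m.

(* Main.v *)
Require Import Defs.
From mathcomp Require Import all_boot all_order all_algebra.
From mathcomp Require Import all_classical all_reals all_analysis.
From mathcomp Require Import ring lra zify.

(** Both halves rest on how much information a large state carries.  If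
    [|y_s|] is large, the step from [s] to [s + 1] reveals
    [a * phi b (y_s)] up to an error of order [W].

    Finitely many exponents.  The law keeps the version space, the set of
    parameters compatible with the data so far, and cancels
    [a * phi b (y_t)] for some [(a, b)] in it, always taking for [b] the first
    exponent, in a fixed enumeration of [B], that still survives.  The
    exponents in use can only move forward along the enumeration, so from some
    time on a single [b] is used, right or wrong.  The estimates made at times
    [t] and [t + 1] both explain every earlier step up to [W], so their
    difference [d] satisfies [d * |y_s|^b <= 2W] for all [s < t], while
    [|y_(t+1)| <= W + d * |y_t|^b].  If the trajectory were unbounded, all
    late times would be records of [|y|], and the logarithm of
    [|y_t| / (3W)] would give a positive sequence with
    [k_(t+2) <= b (k_(t+1) - k_t)].  For [b < 4] the polynomial
    [z^2 - b z + b] has no real root and no such sequence exists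
    ([no_positive_slow_recurrence]).

    An interval of exponents.  Write [a = sigma * exp alpha] with a fixed sign
    and [h_n = ln |y_n|], so that [|a * phi b (y_n)| = exp (alpha + b h_n)].
    Observing step [n] confines [(alpha, b)] to a strip around the line
    [alpha + b h_n = c_n], of width proportional to [exp (- c_n)].  The last
    two strips cut out a parallelogram on which the next exponent
    [alpha + b h_(n+2)] still varies by a multiple of [exp (- c_n)]; the
    adversary answers with whichever of two values puts the state farther from
    the origin, whatever the input was.  This yields
    [h_(n+3) >= b (h_(n+2) - h_n) - K], the recurrence of the polynomial
    [z^3 - b z^2 + b], which has a root above 1 exactly when
    [b >= 3 sqrt 3 / 2], with double root [sqrt 3] at the threshold.  Hence
    [h_(n+1) >= sqrt 3 * h_n] propagates ([escape_invariant]).  The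
    parallelograms are nested and compact, so some [(alpha, b)] lies in all of
    them; it explains the whole unbounded trajectory with admissible
    disturbances ([not_stabilizable_log_box]). *)

Set Implicit Arguments.
Unset Strict Implicit.

Import Order.TTheory GRing.Theory Num.Theory.
Import numFieldNormedType.Exports.
Local Open Scope classical_set_scope.
Local Open Scope ring_scope.

(** * Sequences that grow relative to their past *)

(** With [s = sqrt b], completing the square gives
    [r - b + b / r >= s (2 - s)] for [r > 0], so the recurrence makes the
    ratios [k_(n+1) / k_n] drop by at least [s (2 - s) > 0] at every step:
    they cannot remain positive. *)
Lemma no_positive_slow_recurrence (R : realType) (b : R) (k : nat -> R) :
    0 < b -> b < 4 -> (forall n, 0 < k n) ->
    ~ (forall n, k n.+2 <= b * (k n.+1 - k n)).
Proof.
move=> b0 b4 k0 krec.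
set s := Num.sqrt b.
have s2 : s ^+ 2 = b by rewrite sqr_sqrtr ?ltW.
have s0 : 0 < s by rewrite sqrtr_gt0.
have s_lt2 : s < 2 by nra.
pose d := s * (2 - s).
have d0 : 0 < d by rewrite /d; nra.
have ratio_drop n : k n.+2 / k n.+1 <= k n.+1 / k n - d.
  have kn := k0 n; have kn1 := k0 n.+1.
  rewrite ler_pdivrMr //; apply: le_trans (krec n) _.
  rewrite -subr_ge0.
  have -> : (k n.+1 / k n - d) * k n.+1 - b * (k n.+1 - k n)
      = (k n.+1 - s * k n) ^+ 2 / k n.
    by rewrite /d -s2; field; rewrite gt_eqF.
  by rewrite divr_ge0 ?sqr_ge0 ?ltW.
have ratio_le n : k n.+1 / k n <= k 1%N / k 0%N - n%:R * d.
  elim: n => [|n IH]; first by rewrite mul0r subr0.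
  by apply: le_trans (ratio_drop n) _; rewrite -natr1; lra.
pose r0 := k 1%N / k 0%N.
have r0_ge0 : 0 <= r0 / d by rewrite !divr_ge0 ?ltW.
have := archi_boundP r0_ge0; set n := Num.Def.archi_bound _.
rewrite ltr_pdivrMr // => lt_n.
have := ratio_le n; have : 0 < k n.+1 / k n by rewrite divr_gt0.
by rewrite -/r0; lra.
Qed.

Lemma bounded_prefix (R : realType) (x : nat -> R) (n : nat) :
  exists M, forall s, (s <= n)%N -> x s <= M.
Proof.
elim: n => [|n [M HM]].
  by exists (x 0%N) => s; rewrite leqn0 => /eqP ->.
exists (Num.max M (x n.+1)) => s.
rewrite leq_eqVlt ltnS => /orP[/eqP ->|/HM sM].
  by rewrite le_max lexx orbT.
by rewrite le_max sM.
Qed.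

(** The first time at which [x] exceeds both [M] and its values up to [n] is
    a record. *)
Lemma record_after (R : realType) (x : nat -> R) (M : R) (n : nat) :
    ~ has_ubound (range x) ->
  exists2 t, (n < t)%N & M < x t /\ forall s, (s < t)%N -> x s < x t.
Proof.
move=> unb; have [M' HM'] := bounded_prefix x n.
have ext : exists t, Num.max M M' < x t.
  apply/not_existsP => H; apply: unb; exists (Num.max M M') => _ [t _ <-].
  by rewrite leNgt; apply/negP.
have [t /= Ht tmin] := ex_minnP ext.
move: (Ht); rewrite gt_max => /andP[Mt M't].
exists t; first by rewrite ltnNge; apply/negP => /HM'; rewrite leNgt M't.
split=> // s st; apply: le_lt_trans Ht.
by rewrite leNgt; apply/negP => /tmin; rewrite leqNgt st.
Qed.

(** Growth is limited by the ratio of the current value to the earlier ones,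
    so a value above [3W] can only follow a record.  Going backwards from
    arbitrarily late records, an unbounded sequence is eventually
    increasing, and its logarithms contradict [no_positive_slow_recurrence]. *)
Lemma bounded_of_relative_growth (R : realType) (b W : R) (T : nat)
    (x : nat -> R) :
    0 < b -> b < 4 -> 0 < W -> (forall t, 0 <= x t) ->
    (forall t, (T <= t)%N -> exists2 d, x t.+1 <= W + d * x t `^ b &
       0 <= d /\ forall s, (s < t)%N -> d * x s `^ b <= 2 * W) ->
  has_ubound (range x).
Proof.
move=> b0 b4 W0 x0 growth; apply: contrapT => unb.
pose rec t := forall s, (s < t)%N -> x s < x t.
have rec_pred t : (T <= t)%N -> 3 * W < x t.+1 -> rec t.
  move=> Tt big s st; have [d le_d [d0 ds]] := growth _ Tt.
  rewrite ltNge; apply/negP => xts.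
  have : d * x t `^ b <= d * x s `^ b.
    by rewrite ler_wpM2l // ge0_ler_powR ?nnegrE ?(ltW b0).
  by have := ds _ st; lra.
have [N TN [bigN recN]] := @record_after _ x (3 * W) T unb.
have rec_all n : (N <= n)%N -> rec n.
  move=> Nn; have [t nt [_ rt]] := @record_after _ x 0 n unb.
  have down m : (N + m <= t)%N -> rec (t - m)%N.
    elim: m => [|m IH] Nm; first by rewrite subn0.
    have rm : rec (t - m)%N by apply: IH; lia.
    apply: rec_pred; first by lia.
    have -> : (t - m.+1).+1 = (t - m)%N by lia.
    by apply: lt_trans bigN _; apply: rm; lia.
  have -> : n = (t - (t - n))%N by lia.
  by apply: down; lia.
have big n : 3 * W < x (N + n)%N.
  case: n => [|n]; first by rewrite addn0.
  by apply: lt_trans bigN _; apply: rec_all; lia.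
have W3 : 0 < 3 * W by lra.
have xpos n : 0 < x (N + n)%N by apply: lt_trans (big n).
pose k n := ln (x (N + n)%N / (3 * W)).
apply: (@no_positive_slow_recurrence _ b k b0 b4) => n.
  by rewrite /k ln_gt0 // ltr_pdivlMr ?mul1r.
rewrite /k !ln_div ?posrE //.
(* In [k], the constant [3W] absorbs both the additive [W] and the factor [2W]. *)
have -> : forall u v w : R, (u - w) - (v - w) = u - v by move=> *; ring.
rewrite lerBlDr -ln_div ?posrE // -ln_powR -lnM ?posrE //; last first.
  by rewrite powR_gt0 // divr_gt0.
rewrite ler_ln ?posrE //; last by rewrite mulr_gt0 // powR_gt0 // divr_gt0.
have [] := growth (N + n.+1)%N; first by lia.
rewrite -addnS => d le_d [d0 ds].
have lt_n : x (N + n)%N < x (N + n.+1)%N.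
  by apply: rec_all; rewrite ?leq_addr // addnS.
have dn : d * x (N + n)%N `^ b <= 2 * W by apply: ds; rewrite addnS.
apply: le_trans le_d _.
set r := x (N + n.+1)%N / x (N + n)%N.
have rE : x (N + n.+1)%N = r * x (N + n)%N by rewrite /r divfK // gt_eqF.
have r1 : 1 <= r by rewrite /r ler_pdivlMr // mul1r ltW.
have rb1 : 1 <= r `^ b.
  by rewrite -(powRr0 r) ler_powR // ltW.
rewrite rE powRM //; last by lra.
have : r `^ b * (d * x (N + n)%N `^ b) <= r `^ b * (2 * W).
  by rewrite ler_wpM2l //; lra.
have : W <= r `^ b * W by rewrite ler_peMl // ltW.
by lra.
Qed.

Lemma eventually_constant (f : nat -> nat) (K : nat) :
    (forall t, f t <= f t.+1)%N -> (forall t, f t <= K)%N ->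
  exists T, forall t, (T <= t)%N -> f t = f T.
Proof.
move=> f_inc fK.
have mono : {homo f : m n / (m <= n)%N}.
  by apply: homo_leq => //; exact: leq_trans.
have exP : exists v, `[< exists t, f t = v >].
  by exists (f 0%N); apply/asboolP; exists 0%N.
have ubP v : `[< exists t, f t = v >] -> (v <= K)%N.
  by move=> /asboolP[t <-].
have [v /asboolP[T fT] vmax] := ex_maxnP exP ubP.
exists T => t Tt; apply/eqP; rewrite eqn_leq (mono _ _ Tt) andbT fT.
by apply: vmax; apply/asboolP; exists t.
Qed.

(** * Finitely many exponents: the version-space law *)

(** The exponent is chosen by its rank in [s] and not arbitrarily, so that it
    changes only finitely often while [V] shrinks. *)
Definition prioritized_pick (R : realType) (s : seq R) (V : set (R * R)) :
    R * R :=
  let b := nth 0 s (find (fun b => `[< exists a, V (a, b) >]) s) in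
  (xget 0 [set a | V (a, b)], b).

Definition certainty_equivalent_input (R : realType) (s : seq R)
    (V : set (R * R)) (x : R) : R :=
  - ((prioritized_pick s V).1 * phi (prioritized_pick s V).2 x).

(** The inputs are not recorded separately: the one applied at [t'] is
    recomputed from the version space at [t']. *)
Fixpoint version_space (R : realType) (W : R) (s : seq R) (P : set (R * R))
    (y : nat -> R) (t : nat) : set (R * R) :=
  if t is t'.+1 then
    let V := version_space W s P y t' in
    V `&` [set p | `|y t - certainty_equivalent_input s V (y t')
                     - p.1 * phi p.2 (y t')| <= W]
  else P.

(** [inord] caps the index at [t]; the values so produced beyond time [t] are
    harmless by [eq_version_space]. *)
Definition version_space_law (R : realType) (W : R) (s : seq R)
    (P : set (R * R)) : feedback_law R :=
  fun t row => let y i := row ord0 (inord i) in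
    certainty_equivalent_input s (version_space W s P y t) (y t).

Lemma prioritized_pick_in (R : realType) (s : seq R) (V : set (R * R)) :
  (exists2 p, V p & p.2 \in s) -> V (prioritized_pick s V).
Proof.
move=> [[a b] Vp bs]; rewrite /prioritized_pick.
set q := fun b => `[< _ >].
have : has q s by apply/hasP; exists b => //; apply/asboolP; exists a.
by move=> /(nth_find 0) /asboolP; exact: xgetPex.
Qed.

Lemma eq_version_space (R : realType) (W : R) (s : seq R) (P : set (R * R))
    (y z : nat -> R) (t : nat) :
  (forall i, (i <= t)%N -> y i = z i) ->
  version_space W s P y t = version_space W s P z t.
Proof.
elim: t => [//|t IH] yz /=.
by rewrite IH ?yz // => i it; apply: yz; lia.
Qed.

Lemma version_space_lawE (R : realType) (W : R) (s : seq R)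
    (P : set (R * R)) (y : nat -> R) (t : nat) :
  @version_space_law R W s P t (\row_(i < t.+1) y i) =
  certainty_equivalent_input s (version_space W s P y t) (y t).
Proof.
rewrite /version_space_law mxE inordK //; congr certainty_equivalent_input.
by apply: eq_version_space => i it; rewrite mxE inordK.
Qed.

Lemma phi_norm (R : realType) (b x : R) : 0 < b -> `|phi b x| = `|x| `^ b.
Proof.
move=> b0; rewrite /phi normrM normr_sg (ger0_norm (powR_ge0 _ _)).
have [->|_] := eqVneq x 0; last by rewrite mul1r.
by rewrite normr0 powR0 ?gt_eqF // mul0r.
Qed.

(** Consecutive estimates with a common exponent explain the same past, and
    the later one also explains the newest step; comparing them yields the
    hypotheses of [bounded_of_relative_growth] without any reference to the
    true parameter, which only keeps the version space nonempty. *)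
Lemma stabilizable_finite_exponents (R : realType) (W : R) (A B : set R) :
    0 < W -> finite_set B -> (forall b, B b -> 0 < b < 4) ->
  robustly_stabilizable W (A `*` B).
Proof.
move=> W0 /finite_seqP[s Bs] B04.
set P := A `*` B.
exists (@version_space_law R W s P) => p w y Pp w_le traj.
pose V := version_space W s P y.
pose q t := prioritized_pick s (V t).
have Vstep t : V t.+1 `<=` V t by move=> z [].
have V_anti m n : (m <= n)%N -> V n `<=` V m.
  move=> /subnK <-; elim: (n - m)%N => [//|k IH].
  by apply: subset_trans IH; exact: Vstep.
have Vp t : V t p.
  elim: t => [//|t IH]; split=> //=; rewrite traj version_space_lawE -/(V t).
  set e := (X in `|X|); have -> : e = w t.+1 by rewrite /e; ring.
  exact: w_le.
have ps : p.2 \in s by case: Pp => _; rewrite Bs.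
have Vq t : V t (q t) by apply: prioritized_pick_in; exists p.
have resid t z : V t.+1 z ->
    `|y t.+1 + (q t).1 * phi (q t).2 (y t) - z.1 * phi z.2 (y t)| <= W.
  by move=> [_] /=; rewrite /certainty_equivalent_input -/(V t) -/(q t) opprK.
pose idx t := find (fun b => `[< exists a, V t (a, b) >]) s.
have [T idxT] : exists T, forall t, (T <= t)%N -> idx t = idx T.
  apply: (@eventually_constant _ (size s)) => t; last exact: find_size.
  by apply: sub_find => b /asboolP[a /Vstep Vab]; apply/asboolP; exists a.
pose b := (q T).2.
have qb t : (T <= t)%N -> (q t).2 = b.
  by move=> /idxT idxt; rewrite /b /q /prioritized_pick /= -!/(idx _) idxt.
have /andP[b0 b4] : 0 < b < 4.
  by apply: B04; have /(V_anti 0%N T (leq0n _)) [] := Vq T.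
apply: (@bounded_of_relative_growth _ b W T) => // t Tt.
exists `|(q t.+1).1 - (q t).1|.
  have := resid t _ (Vq t.+1); rewrite !qb; [|lia|lia].
  rewrite -(phi_norm _ b0) -normrM => le_W.
  have -> : y t.+1 = (y t.+1 + (q t).1 * phi b (y t)
      - (q t.+1).1 * phi b (y t)) + ((q t.+1).1 - (q t).1) * phi b (y t).
    by ring.
  by apply: le_trans (ler_normD _ _) _; rewrite lerD2r.
split=> // i it; rewrite -(phi_norm _ b0) -normrM.
(* At time [i] the exponent may not have settled yet; only the exponents of
   the two estimates compared here matter. *)
have h1 := resid i _ (V_anti i.+1 t it _ (Vq t)).
have h2 := resid i _ (V_anti i.+1 t.+1 (leqW it) _ (Vq t.+1)).
rewrite (qb t) ?(qb t.+1) in h1 h2; [|lia..].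
set A1 := (X in `|X| <= W) in h1; set A2 := (X in `|X| <= W) in h2.
have -> : ((q t.+1).1 - (q t).1) * phi b (y i) = A1 - A2.
  by rewrite /A1 /A2; ring.
by apply: le_trans (ler_normB _ _) _; lra.
Qed.

(** * Limits and recursions for the adversary *)

Lemma nested_compact_nonempty (T : topologicalType) (K : set T)
    (Q : nat -> set T) :
    compact K -> Q 0%N `<=` K -> (forall n, closed (Q n)) ->
    (forall n, Q n.+1 `<=` Q n) -> (forall n, Q n !=set0) ->
  exists p, forall n, Q n p.
Proof.
move=> Kc Q0K Qc Qstep Qne.
have Q_anti m n : (m <= n)%N -> Q n `<=` Q m.
  move=> /subnK <-; elim: (n - m)%N => [//|k IH].
  by apply: subset_trans IH; exact: Qstep.
have [x Qx] := choice Qne.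
have xQ n : (x @ \oo) (Q n).
  by exists n => // k /= nk; apply: Q_anti nk _ _.
have [p [_ clp]] := Kc (x @ \oo) _ (filterS Q0K (xQ 0%N)).
by exists p => n; apply: Qc => B nB; exact: clp (xQ n) nB.
Qed.

Lemma course_of_values (X : Type) (x0 : X) (G : nat -> (nat -> X) -> X) :
    (forall t f g, (forall s, (s < t)%N -> f s = g s) -> G t f = G t g) ->
  exists f, forall t, f t = G t f.
Proof.
move=> Gext.
pose Y := fix Y t := if t is t'.+1 then
  fun s => if s == t' then G t' (Y t') else Y t' s else fun=> x0.
pose f t := Y t.+1 t.
have fE t : f t = G t (Y t) by rewrite /f /= eqxx.
have Yf t s : (s < t)%N -> Y t s = f s.
  elim: t => [//|t IH]; rewrite ltnS leq_eqVlt => /orP[/eqP -> //|st].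
  by rewrite /= (ltn_eqF st) IH.
by exists f => t; rewrite fE; apply: Gext; exact: Yf.
Qed.

(** * Strips of parameters left by the observations *)

(** The height at [h2] of the line through [(h0, c0)] and [(h1, c1)]: the
    value of [alpha + b * h2] at the centre of the current parallelogram. *)
Definition extrapolate (R : realType) (h0 h1 h2 c0 c1 : R) : R :=
  c1 + (c1 - c0) / (h1 - h0) * (h2 - h1).

(** The change of [alpha + b * h2] when its value at [h1] is kept and its value
    at [h0] is lowered by half of the deviation that the strip allows there; the
    other half is the room in which the next parallelogram fits. *)
Definition tilt (R : realType) (kappa h0 h1 h2 c0 : R) : R :=
  (h2 - h1) / (h1 - h0) * (kappa * expR (- c0)) / 2.

Definition strip (R : realType) (kappa h c : R) : set (R * R) :=
  [set p | `|p.1 + p.2 * h - c| <= kappa * expR (- c)].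

Lemma closed_strip (R : realType) (kappa h c : R) : closed (strip kappa h c).
Proof.
have cont : continuous (fun p : R * R => `|p.1 + p.2 * h - c|).
  move=> p; apply: cvg_norm; apply: cvgB; last exact: cvg_cst.
  by apply: cvgD; [exact: cvg_fst|apply: cvgM; [exact: cvg_snd|exact: cvg_cst]].
apply: (@closed_comp _ _ _ [set x : R | x <= kappa * expR (- c)]).
  by move=> p _; exact: cont.
exact: closed_le.
Qed.

(** By linear interpolation, the deviation at [h0] is a combination of
    the deviations at [h1] and [h2], plus at most half the deviation allowed
    at [h0].  The bound on [h1 - h0] keeps the coefficients at most 3 and 2
    however large [h2] is, and a gap of 9 between the [c] makes each strip 10
    times thinner than the previous one, as [exp 9 >= 10]. *)
Lemma strip_nesting (R : realType) (kappa h0 h1 h2 c0 c1 c2 : R) :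
    0 < kappa -> h0 < h1 -> h1 - h0 <= 2 * (h2 - h1) ->
    c0 + 9 <= c1 -> c1 + 9 <= c2 ->
    let m := extrapolate h0 h1 h2 c0 c1 in
    c2 = m \/ c2 = m + tilt kappa h0 h1 h2 c0 ->
  strip kappa h1 c1 `&` strip kappa h2 c2 `<=` strip kappa h0 c0.
Proof.
move=> k0 h01 h12 c01 c12 m c2E [al b] [p1 p2].
have dh : 0 < h1 - h0 by rewrite subr_gt0.
have eps_drop (c c' : R) : c + 9 <= c' ->
    10 * (kappa * expR (- c')) <= kappa * expR (- c).
  move=> cc'; rewrite mulrCA ler_pM2l //.
  have -> : - c = (c' - c) + - c' by ring.
  rewrite expRD ler_wpM2r ?expR_ge0 //.
  by have := expR_ge1Dx (c' - c); lra.
have e01 := eps_drop _ _ c01; have e12 := eps_drop _ _ c12.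
set e0 := kappa * expR (- c0) in e01 *.
set e1 := kappa * expR (- c1) in e01 e12 *.
set e2 := kappa * expR (- c2) in e12 *.
have e0_ge0 : 0 <= e0 by rewrite mulr_ge0 ?expR_ge0 ?ltW.
set rho := (h2 - h1) / (h1 - h0).
have rho_half : 1 / 2 <= rho by rewrite ler_pdivlMr //; lra.
have tiltE : 0 <= c2 - m <= rho * e0 / 2.
  have : 0 <= rho * e0 by rewrite mulr_ge0 //; lra.
  by case: c2E => ->; rewrite /tilt -/rho -/e0; lra.
have key : rho * (al + b * h0 - c0) =
    (rho + 1) * (al + b * h1 - c1) - (al + b * h2 - c2) - (c2 - m).
  by rewrite /m /extrapolate /rho; field; lra.
have rho0 : 0 < rho by lra.
rewrite /strip /= -(ler_pM2l rho0) -{1}(gtr0_norm rho0) -normrM key -/e0.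
move: p1 p2; rewrite /strip /= -/e1 -/e2 !ler_norml => /andP[p1l p1r] /andP[p2l p2r].
move: tiltE => /andP[t0 t1].
have u1 : (rho + 1) * (al + b * h1 - c1) <= (rho + 1) * e1.
  by rewrite ler_wpM2l //; lra.
have u2 : - ((rho + 1) * e1) <= (rho + 1) * (al + b * h1 - c1).
  by rewrite -mulrN ler_wpM2l //; lra.
have e1r : rho * (10 * e1) <= rho * e0 by rewrite ler_pM2l.
have e0r : 1 / 2 * e0 <= rho * e0 by rewrite ler_wpM2r.
by apply/andP; split; lra.
Qed.

(** Being in the strip of an observation means explaining it with a
    disturbance at most [W]. *)
Lemma expR_near (R : realType) (kappa W c v : R) :
    0 <= kappa -> kappa <= 1 / 2 -> 2 * kappa <= W -> 0 <= c ->
  `|v - c| <= kappa * expR (- c) -> `|expR c - expR v| <= W.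
Proof.
move=> k0 k2 kW c0 vc.
set d := kappa * expR (- c) in vc.
have dc : d * expR c = kappa by rewrite /d -mulrA -expRD addNr expR0 mulr1.
have d0 : 0 <= d by rewrite mulr_ge0 ?expR_ge0.
have d2 : d <= 1 / 2.
  apply: le_trans k2; rewrite /d ler_piMr //.
  by rewrite -[leRHS]expR0 ler_expR oppr_le0.
have up : expR d <= 1 + 2 * d.
  have := expR_ge1Dx (- d); have := expR_gt0 d.
  have : expR d * expR (- d) = 1 by rewrite -expRD addrN expR0.
  by move: (expR d) (expR (- d)) => x z; nra.
have vE : expR v = expR (v - c) * expR c by rewrite -expRD subrK.
move: vc; rewrite ler_norml => /andP[vcl vcr].
have lo := expR_ge1Dx (v - c).
have hi : expR (v - c) <= 1 + 2 * d by apply: le_trans up; rewrite ler_expR.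
have cpos := expR_gt0 c.
have l1 : (1 - 2 * d) * expR c <= expR v by rewrite vE ler_wpM2r ?(ltW cpos) //; lra.
have l2 : expR v <= (1 + 2 * d) * expR c by rewrite vE ler_wpM2r ?(ltW cpos).
by rewrite ler_norml; apply/andP; split; lra.
Qed.

(** The point where the central lines of two strips cross. *)
Lemma strips_centre (R : realType) (kappa h0 h1 c0 c1 : R) :
    0 < kappa -> h0 < h1 -> let beta := (c1 - c0) / (h1 - h0) in
  (strip kappa h0 c0 `&` strip kappa h1 c1) (c0 - beta * h0, beta).
Proof.
move=> k0 h01 beta.
have e_ge0 x : 0 <= kappa * expR (- x) by rewrite mulr_ge0 ?expR_ge0 ?ltW.
split; rewrite /strip /=; first by rewrite subrK subrr normr0.
set z := (X in `|X|); have -> : z = 0; last by rewrite normr0.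
by rewrite /z /beta; field; lra.
Qed.

(** * The adversary *)

Definition farther_exponent (R : realType) (u e m m' : R) : R :=
  if `|u + e * expR m| < `|u + e * expR m'| then m' else m.

(** The two candidate states are [expR m' - expR m] apart, so they cannot both
    be close to the origin, whatever the input [u] is. *)
Lemma farther_exponent_gap (R : realType) (u e m m' : R) : `|e| = 1 ->
  (expR m' - expR m) / 2 <= `|u + e * expR (farther_exponent u e m m')|.
Proof.
move=> e1.
have le_sum : expR m' - expR m <= `|u + e * expR m| + `|u + e * expR m'|.
  apply: le_trans (ler_norm _) _.
  rewrite -[leLHS]mul1r -e1 -normrM.
  have -> : e * (expR m' - expR m) = (u + e * expR m') - (u + e * expR m).
    by ring.
  by rewrite [leRHS]addrC; exact: ler_normB.
by rewrite /farther_exponent; case: ltP => ?; lra.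
Qed.

(** The exponent on the left is [extrapolate h0 h1 h2 c0 c1 - c0]: a
    relative uncertainty of order [exp (- c0)] is carried to scale [exp m]. *)
Lemma extrapolation_gain (R : realType) (kappa h0 h1 h2 c0 c1 m : R) :
    0 < kappa -> h0 < h1 -> h1 - h0 <= 2 * (h2 - h1) ->
    m = extrapolate h0 h1 h2 c0 c1 ->
  kappa / 8 * expR ((c1 - c0) / (h1 - h0) * (h2 - h0)) <=
  (expR (m + tilt kappa h0 h1 h2 c0) - expR m) / 2.
Proof.
move=> k0 h01 h12 mE.
have dh : 0 < h1 - h0 by rewrite subr_gt0.
have -> : (c1 - c0) / (h1 - h0) * (h2 - h0) = m - c0.
  by rewrite mE /extrapolate; field; lra.
rewrite expRD /tilt [expR (m + _)]expRD; set rho := (h2 - h1) / (h1 - h0).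
have rho_half : 1 / 2 <= rho by rewrite ler_pdivlMr //; lra.
have e0 := expR_gt0 (- c0); have em := expR_gt0 m.
have := expR_ge1Dx (rho * (kappa * expR (- c0)) / 2).
set E := expR (rho * _ / 2) => lo.
have ke : 0 < kappa * expR (- c0) by rewrite mulr_gt0.
have : 1 / 2 * (kappa * expR (- c0)) <= rho * (kappa * expR (- c0)).
  by rewrite ler_wpM2r // ltW.
move: ke lo; set z := kappa * expR (- c0) => z0 lo half.
have -> : kappa / 8 * (expR m * expR (- c0)) = expR m * (z / 8).
  by rewrite /z; ring.
have -> : (expR m * E - expR m) / 2 = expR m * ((E - 1) / 2) by ring.
by rewrite ler_pM2l //; lra.
Qed.

Lemma phi_expR (R : realType) (b x : R) : x != 0 ->
  phi b x = Num.sg x * expR (b * ln `|x|).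
Proof. by move=> x0; rewrite /phi /powR normr_eq0 (negbTE x0). Qed.

(** The states are shifted by two: [y 2] is the initial state of the system,
    while [y 0] and [y 1] are fictitious observations whose strips cut out the
    first parallelogram.  The state [y n.+3] is the one reached by the
    exponent [c n.+2] without disturbance. *)
Lemma adversarial_orbit (R : realType) (mu : feedback_law R)
    (kappa sigma y0 y1 y2 d0 d1 : R) : `|sigma| = 1 ->
  exists y c : nat -> R,
    [/\ [/\ y 0%N = y0, y 1%N = y1 & y 2 = y2], c 0%N = d0, c 1%N = d1 &
    forall n,
    let u := mu n (\row_(i < n.+1) y i.+2) in
    let h i := ln `|y i| in
    let m := extrapolate (h n) (h n.+1) (h n.+2) (c n) (c n.+1) in
    let m' := m + tilt kappa (h n) (h n.+1) (h n.+2) (c n) in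
    [/\ y n.+3 = u + sigma * Num.sg (y n.+2) * expR (c n.+2),
        c n.+2 = m \/ c n.+2 = m' &
        y n.+2 != 0 -> (expR m' - expR m) / 2 <= `|y n.+3|]].
Proof.
move=> sigma1.
(* The recursion runs on the pairs [(y n, c n.-1)], because [c n.+2] is chosen
   together with [y n.+3]. *)
pose U n (f : nat -> R * R) := mu n (\row_(i < n.+1) (f i.+2).1).
pose h (f : nat -> R * R) i := ln `|(f i).1|.
pose M n f := extrapolate (h f n) (h f n.+1) (h f n.+2) (f n.+1).2 (f n.+2).2.
pose M' n f :=
  M n f + tilt kappa (h f n) (h f n.+1) (h f n.+2) (f n.+1).2.
pose e n (f : nat -> R * R) := sigma * Num.sg (f n.+2).1.
pose C n f := farther_exponent (U n f) (e n f) (M n f) (M' n f).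
pose G t f := match t with
  | 0 => (y0, 0) | 1 => (y1, d0) | 2 => (y2, d1)
  | n.+3 => (U n f + e n f * expR (C n f), C n f) end.
have Gext t f g : (forall s, (s < t)%N -> f s = g s) -> G t f = G t g.
  case: t => [|[|[|n]]] //= fg.
  have eqU : U n f = U n g.
    apply: (congr1 (mu n)); apply/rowP => i; rewrite !mxE fg // !ltnS.
    by case: i.
  by rewrite /C /M' /M /h /e eqU !fg; [|lia..].
have [f fE] := course_of_values (0, 0) Gext.
exists (fun n => (f n).1), (fun n => (f n.+1).2).
split; [by split; rewrite fE|by rewrite fE|by rewrite fE|].
move=> n u hh m m'.
have f3 : f n.+3 = (U n f + e n f * expR (C n f), C n f) by rewrite fE.
split.
- by rewrite f3.
- by rewrite f3 /= /C /farther_exponent; case: ifP => _; [right|left].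
- move=> yn0; rewrite f3; apply: farther_exponent_gap.
  by rewrite /e normrM sigma1 normr_sg yn0 mul1r.
Qed.

(** * Propagation of the growth *)

Lemma sqrt3_bounds (R : realType) :
  [/\ Num.sqrt (3 : R) * Num.sqrt 3 = 3, 17 / 10 < Num.sqrt (3 : R)
    & Num.sqrt (3 : R) < 2].
Proof.
have s0 : 0 <= Num.sqrt (3 : R) by rewrite sqrtr_ge0.
have s2 : Num.sqrt (3 : R) * Num.sqrt 3 = 3 by rewrite -expr2 sqr_sqrtr.
by split => //; nra.
Qed.

Lemma sqrt3_growth (R : realType) (h0 h1 h2 : R) :
    18 <= h0 -> Num.sqrt 3 * h0 <= h1 -> Num.sqrt 3 * h1 <= h2 ->
  [/\ 9 <= h1 - h0, 9 <= h2 - h1, h1 - h0 <= 2 * (h2 - h1) & 3 * h0 <= h2].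
Proof.
have [SS S17 _] := sqrt3_bounds R; move: SS S17.
set S := Num.sqrt 3 => SS S17 Hh S01 S12.
have l01 : 17 / 10 * h0 <= S * h0 by rewrite ler_pM2r; lra.
have l12 : 17 / 10 * h1 <= S * h1 by rewrite ler_pM2r; lra.
have l02 : 3 * h0 <= S * h1 by rewrite -SS -mulrA ler_pM2l //; lra.
by split; lra.
Qed.

(** The exponential gain turns into growth by the factor [S]: the part
    [h0 <= h2 / 3] lost in the difference leaves the factor [2 / 3 * B], and the
    surplus [2 / 3 * B - S] pays for the constant [L] once [h2 >= H]. *)
Lemma recurrence_gain (R : realType) (S B L H beta h0 h2 h3 : R) :
    0 <= B -> B <= beta -> S <= 2 / 3 * B -> - L <= (2 / 3 * B - S) * H ->
    H <= h2 -> 0 <= h0 -> 3 * h0 <= h2 -> L + beta * (h2 - h0) <= h3 ->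
  S * h2 <= h3.
Proof.
move=> B0 Bbeta SB LH Hh2 h0_ge0 h02 gain.
have : B * (2 / 3 * h2) <= beta * (h2 - h0).
  by clear SB LH gain; apply: ler_pM; lra.
have : (2 / 3 * B - S) * H <= (2 / 3 * B - S) * h2.
  by rewrite ler_wpM2l // subr_ge0.
by clear Hh2 SB Bbeta; lra.
Qed.

Definition parameter_box (R : realType) (al0 b0 r : R) : set (R * R) :=
  [set p | `|p.1 - al0| <= r /\ `|p.2 - b0| <= r].

Lemma parameter_box_sub (R : realType) (al0 b0 r : R) :
  parameter_box al0 b0 r `<=` `[al0 - r, al0 + r] `*` `[b0 - r, b0 + r].
Proof. by move=> p [p1 p2]; split; rewrite /= in_itv /= -ler_distl. Qed.

(** Subtracting the two strip conditions bounds [(b - b0) * H], then [al - al0],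
    by their half-widths, each at most [r / 3] because [exp (- c) <= 1 / c] and
    [c >= 3 / r]. *)
Lemma initial_strips_in_box (R : realType) (kappa al0 b0 r H : R) :
    0 < kappa -> kappa <= 1 -> 0 < r -> 1 <= b0 -> 1 <= H ->
    `|al0| + 3 / r <= H ->
  strip kappa H (al0 + b0 * H) `&` strip kappa (2 * H) (al0 + b0 * (2 * H))
    `<=` parameter_box al0 b0 r.
Proof.
move=> k0 k1 r0 b1 H1 Hbig [al b] []; rewrite /strip /=.
have H0 : 0 <= H by lra.
have bH : H <= b0 * H by rewrite ler_peMl.
have := ler_norm (- al0); rewrite normrN => al_le.
have c_le : 3 / r <= al0 + b0 * H by lra.
have eps_le c : 3 / r <= c -> kappa * expR (- c) <= r / 3.
  move=> rc; apply: (@le_trans _ _ (expR (- c))).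
    by rewrite ler_piMl ?expR_ge0.
  rewrite expRN -[r / 3]invf_div lef_pV2 ?posrE ?expR_gt0 ?divr_gt0 //.
  by have := expR_ge1Dx c; lra.
move=> /le_trans /(_ (eps_le _ c_le)).
have c1_le : 3 / r <= al0 + b0 * (2 * H) by lra.
move=> + /le_trans /(_ (eps_le _ c1_le)).
rewrite !ler_norml => /andP[p1 p2] /andP[q1 q2].
have bb : `|b - b0| <= 2 / 3 * r.
  have : `|(b - b0) * H| <= 2 / 3 * r.
    by rewrite ler_norml; apply/andP; split; lra.
  rewrite normrM (ger0_norm H0); apply: le_trans.
  by rewrite ler_peMr.
split; last by apply: le_trans bb _; lra.
by rewrite /= ler_norml; apply/andP; split; lra.
Qed.

Definition cell (R : realType) (kappa : R) (h c : nat -> R) (n : nat) :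
    set (R * R) :=
  strip kappa (h n) (c n) `&` strip kappa (h n.+1) (c n.+1).

Definition escape_state (R : realType) (kappa H : R) (K : set (R * R))
    (h c : nat -> R) (n : nat) : Prop :=
  [/\ H <= h n, Num.sqrt 3 * h n <= h n.+1,
      Num.sqrt 3 * h n.+1 <= h n.+2, 0 <= c n & cell kappa h c n `<=` K].

(** Since the centre of the cell lies in the box, the slope of the line through
    its two data points is an admissible exponent, at least [b0 - r].  The
    inequality [sqrt 3 <= 2 / 3 * (b0 - r)] needed for [recurrence_gain] is
    where the threshold [3 sqrt 3 / 2] enters.  Nothing bounds [h] from above,
    so the input may push the state as far out as it likes. *)
Lemma escape_invariant (R : realType) (kappa al0 b0 r H : R)
    (h c : nat -> R) :
    0 < kappa -> kappa <= 1 -> 0 < r -> 3 * Num.sqrt 3 / 2 < b0 - r ->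
    18 <= H -> `|al0| + 3 / r <= H ->
    - ln (kappa / 8) <= (2 / 3 * (b0 - r) - Num.sqrt 3) * H ->
    [/\ h 0%N = H, h 1%N = 2 * H & h 2 = 4 * H] ->
    c 0%N = al0 + b0 * H -> c 1%N = al0 + b0 * (2 * H) ->
    (forall n,
      let m := extrapolate (h n) (h n.+1) (h n.+2) (c n) (c n.+1) in
      let m' := m + tilt kappa (h n) (h n.+1) (h n.+2) (c n) in
      (c n.+2 = m \/ c n.+2 = m') /\
      (0 < h n.+2 -> (expR m' - expR m) / 2 <= expR (h n.+3))) ->
  forall n, escape_state kappa H (parameter_box al0 b0 r) h c n /\
    cell kappa h c n.+1 `<=` cell kappa h c n.
Proof.
move=> k0 k1 r0 bS H18 Hbig Hgain [h0E h1E h2E] c0E c1E step.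
have [SS S17 S2] := sqrt3_bounds R.
move: SS S17 S2 bS Hgain; set S := Num.sqrt 3 => SS S17 S2 bS Hgain.
pose B := b0 - r.
pose Inv n := escape_state kappa H (parameter_box al0 b0 r) h c n.
suff main n : Inv n -> Inv n.+1 /\ cell kappa h c n.+1 `<=` cell kappa h c n.
  have Inv_all n : Inv n.
    elim: n => [|n /main[]//].
    have alH : - al0 <= H.
      have : 0 < 3 / r by rewrite divr_gt0.
      by have := ler_norm (- al0); rewrite normrN; lra.
    have b0H : H <= b0 * H by rewrite ler_peMl //; lra.
    rewrite /Inv /escape_state /cell -/S.
    split; rewrite ?h0E ?h1E ?h2E ?c0E ?c1E //.
    - by rewrite ler_wpM2r //; lra.
    - by have : S * H <= 2 * H by [rewrite ler_wpM2r //; lra]; lra.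
    - by lra.
    - by apply: initial_strips_in_box => //; lra.
  by move=> n; split; [exact: Inv_all|case: (main n)].
rewrite /Inv /escape_state /cell -/S => -[Hh S01 S12 c_ge box].
have [c2E gain] := step n.
set h0 := h n in Hh S01 box c2E gain *; set h1 := h n.+1 in S01 S12 box c2E gain *.
set h2 := h n.+2 in S12 c2E gain *; set c0 := c n in c_ge box c2E gain *.
set c1 := c n.+1 in box c2E gain *.
set m := extrapolate _ _ _ _ _ in c2E gain.
set t := tilt _ _ _ _ _ in c2E gain.
have h0_18 : 18 <= h0 := le_trans H18 Hh.
have [d01 d12 h12 h02] := sqrt3_growth h0_18 S01 S12.
have h0_ge0 : 0 <= h0 by apply: le_trans h0_18.
have h01 : h0 < h1 by rewrite -subr_gt0; apply: lt_le_trans d01.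
have h12' : h1 < h2 by rewrite -subr_gt0; apply: lt_le_trans d12.
pose beta := (c1 - c0) / (h1 - h0).
have B_beta : B <= beta.
  have [_] := box _ (strips_centre c0 c1 k0 h01).
  by rewrite /= ler_norml lerBrDl => /andP[].
have B1 : 1 <= B.
  have -> : B = b0 - r by [].
  by clear -S17 bS; lra.
have step_up (x : R) : 9 <= x -> 9 <= beta * x.
  move=> x9; apply: (le_trans x9); rewrite ler_peMl ?(le_trans B1) //.
  exact: le_trans x9.
have c01 : c0 + 9 <= c1.
  rewrite addrC -lerBrDr.
  have -> : c1 - c0 = beta * (h1 - h0) by rewrite divfK // gt_eqF ?subr_gt0.
  exact: step_up.
have t_ge0 : 0 <= t.
  have e_ge0 : 0 <= kappa * expR (- c0) by rewrite mulr_ge0 ?expR_ge0 ?ltW.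
  by rewrite /t /tilt divr_ge0 // mulr_ge0 // divr_ge0 // subr_ge0 ltW.
have c12 : c1 + 9 <= c n.+2.
  have m9 : c1 + 9 <= m by rewrite /m /extrapolate lerD2l; exact: step_up.
  by case: c2E => -> //; apply: le_trans m9 _; rewrite lerDl.
have nest : strip kappa h1 c1 `&` strip kappa h2 (c n.+2) `<=` strip kappa h0 c0.
  exact: (strip_nesting k0 h01 h12 c01 c12 c2E).
have nest' : strip kappa h1 c1 `&` strip kappa h2 (c n.+2) `<=`
    strip kappa h0 c0 `&` strip kappa h1 c1.
  by move=> p p12; split; [exact: nest|case: p12].
have Hh1 : H <= h1 by rewrite (le_trans Hh) ?ltW.
have Hh2 : H <= h2 by rewrite (le_trans Hh1) ?ltW.
split; last exact: nest'.
split; [exact: Hh1|exact: S12| | |].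
- have h2_gt0 : 0 < h2 by apply: lt_le_trans Hh2; apply: lt_le_trans H18.
  have := le_trans (extrapolation_gain k0 h01 h12 (erefl m)) (gain h2_gt0).
  rewrite -/beta -[kappa / 8]lnK ?posrE ?divr_gt0 // -expRD ler_expR.
  apply: (recurrence_gain _ B_beta _ Hgain) => //; first exact: le_trans B1.
  have -> : B = b0 - r by [].
  by clear -bS; lra.
- by apply: le_trans c_ge _; apply: le_trans c01; rewrite lerDl.
- exact: subset_trans nest' box.
Qed.

(** The parameter common to all cells is only known after the game, but each
    step of the orbit lies in its strip, hence is explained by it with a
    disturbance at most [W]. *)
Lemma not_stabilizable_log_box (R : realType) (W sigma al0 b0 r : R)
    (P : set (R * R)) :
    0 < W -> `|sigma| = 1 -> 0 < r -> 3 * Num.sqrt 3 / 2 < b0 - r ->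
    (forall p, parameter_box al0 b0 r p -> P (sigma * expR p.1, p.2)) ->
  ~ robustly_stabilizable W P.
Proof.
move=> W0 sigma1 r0 bS boxP [mu stab].
pose kappa := Num.min (1 / 2) (W / 2).
have k0 : 0 < kappa by rewrite lt_min; apply/andP; split; lra.
have k_half : kappa <= 1 / 2 by rewrite ge_min lexx.
have kW : 2 * kappa <= W.
  have : kappa <= W / 2 by rewrite ge_min lexx orbT.
  by lra.
pose gap := 2 / 3 * (b0 - r) - Num.sqrt 3.
have gap0 : 0 < gap by rewrite /gap; lra.
(* [18] makes the gaps between the [h n] at least 9, the next term places the
   first cell in the box, and the last one absorbs the constant of the gain. *)
pose H := Num.max 18 (Num.max (`|al0| + 3 / r) (- ln (kappa / 8) / gap)).
have H18 : 18 <= H by rewrite /H le_max lexx.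
have Hbig : `|al0| + 3 / r <= H by rewrite /H !le_max lexx orbT.
have Hgain : - ln (kappa / 8) <= gap * H.
  by rewrite [gap * H]mulrC -ler_pdivrMr // /H !le_max lexx !orbT.
have [y [c [[y0 y1 y2] c0 c1 step]]] := adversarial_orbit mu kappa
  (expR H) (expR (2 * H)) (expR (4 * H)) (al0 + b0 * H) (al0 + b0 * (2 * H))
  sigma1.
pose h n := ln `|y n|.
have h_ge_norm x : `|x : R| <= expR (ln `|x|).
  have [->|x0] := eqVneq x 0; first by rewrite normr0 expR_ge0.
  by rewrite lnK // posrE normr_gt0.
have hN0 n : 0 < h n -> y n != 0.
  by apply: contraTneq => yn0; rewrite /h yn0 normr0 ln0 // ltxx.
pose box := parameter_box al0 b0 r.
have inv n : escape_state kappa H box h c n /\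
    cell kappa h c n.+1 `<=` cell kappa h c n.
  apply: (escape_invariant k0 _ r0 bS H18 Hbig Hgain _ c0 c1).
  - by lra.
  - by split; rewrite /h ?y0 ?y1 ?y2 gtr0_norm ?expR_gt0 // expRK.
  - move=> {}n m m'; have [_ cE gain] := step n; split=> // h2.
    exact: le_trans (gain (hN0 _ h2)) (h_ge_norm _).
have h_inc n : h n + 1 <= h n.+1.
  have [[Hn S1 S2 _ _] _] := inv n.
  have [d01 _ _ _] := sqrt3_growth (le_trans H18 Hn) S1 S2.
  by rewrite addrC -lerBrDr; apply: le_trans d01; rewrite ler1n.
have y_neq0 n : y n != 0.
  apply: hN0; have [[Hn _ _ _ _] _] := inv n.
  by apply: lt_le_trans Hn; apply: lt_le_trans H18.
have [p Qp] : exists p, forall n, cell kappa h c n p.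
  apply: (@nested_compact_nonempty _ (`[al0 - r, al0 + r] `*` `[b0 - r, b0 + r])).
  - by apply: compact_setX; exact: segment_compact.
  - have [[_ _ _ _ sub_box] _] := inv 0%N.
    by apply: subset_trans sub_box _; exact: parameter_box_sub.
  - by move=> n; apply: closedI; exact: closed_strip.
  - by move=> n; case: (inv n).
  - move=> n; eexists; apply: (strips_centre _ _ k0).
    by apply: lt_le_trans (h_inc n); rewrite ltrDl.
have Pp : P (sigma * expR p.1, p.2).
  apply: boxP; have [[_ _ _ _ sub_box] _] := inv 0%N; exact: sub_box (Qp 0%N).
pose x n := y n.+2.
pose w n := if n is n'.+1 then
  x n'.+1 - mu n' (\row_(i < n'.+1) x i) - sigma * expR p.1 * phi p.2 (x n')
  else 0.
have w_le n : (1 <= n)%N -> `|w n| <= W.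
  case: n => // n _; rewrite /w /x.
  have [-> _ _] := step n.
  rewrite phi_expR // -/(h n.+2).
  set z := (X in `|X|).
  have -> : z = sigma * Num.sg (y n.+2) *
      (expR (c n.+2) - expR (p.1 + p.2 * h n.+2)).
    by rewrite /z expRD; ring.
  rewrite !normrM sigma1 normr_sg y_neq0 !mul1r.
  have [[_ _ _ c_ge _] _] := inv n.+2; have [Qn _] := Qp n.+2.
  exact: expR_near (ltW k0) k_half kW c_ge Qn.
have traj : trajectory mu (sigma * expR p.1) p.2 w x.
  by move=> n; rewrite /w; ring.
have [M ubM] := stab _ w x Pp w_le traj.
have h_ge n : n%:R <= h n.
  elim: n => [|n IH].
    by have [[H0 _ _ _ _] _] := inv 0%N; apply: le_trans H0; apply: le_trans H18.
  by rewrite -natr1; apply: le_trans (h_inc n); rewrite lerD2r.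
pose N := Num.Def.archi_bound `|M|.
have MN : M < N%:R by apply: le_lt_trans (ler_norm _) (archi_boundP _).
have xM : `|x N| <= M by apply: ubM; exists N.
have hx : h N.+2 <= `|x N|.
  have := expR_ge1Dx (h N.+2); rewrite {2}/h lnK ?posrE ?normr_gt0 //.
  by apply: le_trans; rewrite lerDr.
have Nh : N%:R <= h N.+2 by apply: le_trans (h_ge N.+2); rewrite ler_nat leqW.
by have := lt_le_trans MN (le_trans Nh (le_trans hx xM)); rewrite ltxx.
Qed.

(** * Conclusion *)

Lemma log_subinterval (R : realType) (a1 a2 : R) : a1 < a2 ->
  exists sigma al0 r : R, [/\ `|sigma| = 1, 0 < r
    & forall al, `|al - al0| <= r -> a1 <= sigma * expR al <= a2].
Proof.
have pos (a a' : R) : 0 <= a -> a < a' -> exists al0 r : R, 0 < r /\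
    forall al, `|al - al0| <= r -> a <= expR al <= a'.
  move=> a0 aa'; pose l := ln ((a + a') / 2); pose u := ln a'.
  have m0 : 0 < (a + a') / 2 by lra.
  have lu : l < u by rewrite ltr_ln ?posrE; lra.
  exists ((l + u) / 2), ((u - l) / 2); split; first by lra.
  move=> al; rewrite ler_norml => /andP[al1 al2].
  have : expR l <= expR al by rewrite ler_expR; lra.
  have : expR al <= expR u by rewrite ler_expR; lra.
  rewrite !lnK ?posrE //; [|lra..].
  by move=> ? ?; apply/andP; split; lra.
move=> a12; have [a2_gt0|a2_le0] := ltP 0 a2.
  have [] := pos (Num.max 0 a1) a2; rewrite ?le_max ?lexx // ?gt_max ?a2_gt0 //.
  move=> al0 [r [r0 H]]; exists 1, al0, r; split; rewrite ?normr1 // => al /H.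
  by rewrite mul1r ge_max => /andP[/andP[_ ->] ->].
have [] := pos (- a2) (- a1); [lra|lra|].
move=> al0 [r [r0 H]]; exists (-1), al0, r; split; rewrite ?normrN1 // => al /H.
by rewrite mulN1r => /andP[? ?]; apply/andP; split; lra.
Qed.

Theorem corollary3p5 (R : realType) (W : R) (hW : 0 < W)
    (a1 a2 : R) (ha : a1 < a2)
    (B : set R) (hBfin : finite_set B) (hB0 : B !=set0)
    (hBpos : forall b : R, B b -> 0 < b)
    (bmin bmax : R) (hbmin : is_minimum B bmin) (hbmax : is_maximum B bmax)
    (hlt : bmin < bmax)
    (hlo : 3 * Num.sqrt 3 / 2 < bmax) (hhi : bmax < 4) :
  robustly_stabilizable W (`[a1, a2] `*` B) /\
  ~ robustly_stabilizable W (`[a1, a2] `*` `[bmin, bmax]).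
Proof.
split.
  apply: stabilizable_finite_exponents => // b Bb.
  rewrite hBpos //=; apply: le_lt_trans hhi.
  by case: hbmax => _; apply.
have [sigma [al0 [r [sigma1 r0 alP]]]] := log_subinterval ha.
pose lo := Num.max bmin (3 * Num.sqrt 3 / 2).
have lo_lt : lo < bmax by rewrite gt_max hlt hlo.
have lo_min : bmin <= lo by rewrite le_max lexx.
have lo_crit : 3 * Num.sqrt 3 / 2 <= lo by rewrite le_max lexx orbT.
pose r' := Num.min r ((bmax - lo) / 4).
have r'r : r' <= r by rewrite ge_min lexx.
have r'b : r' <= (bmax - lo) / 4 by rewrite ge_min lexx orbT.
have r'0 : 0 < r' by rewrite lt_min r0 /=; lra.
apply: (@not_stabilizable_log_box _ W sigma al0 ((lo + bmax) / 2) r') => //.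
  by lra.
move=> [al b] [/= h1]; rewrite ler_norml => /andP[h2 h3].
split=> /=; rewrite in_itv /=; last by apply/andP; split; lra.
by apply: alP; exact: le_trans h1 r'r.
Qed.
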